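(* Let $(X,\perp)$ be a linear orthogonality space of rank $2$. Then $(X,\perp)=\mathbf{2}(A,B,\varphi)$ for some disjoint sets $A$ and $B$ with $|A|\geq 2$ and a bijection $\varphi\colon A\to B$. Moreover, any orthogonality space $(X,\perp)$ of this form (i.e. $(X,\perp)=\mathbf{2}(A,B,\varphi)$ with $A,B$ disjoint, $|A|\geq 2$ and $\varphi\colon A\to B$ a bijection) has rank $2$ and is linear.
   Context: An orthogonality space is a non-empty set $X$ equipped with a symmetric, irreflexive binary relation $\perp$. The rank of $(X,\perp)$ is the supremum of the cardinalities of sets of mutually orthogonal elements of $X$. For $A\subseteq X$, $A^{\perp}=\{x\in X: x\perp a \text{ for all } a\in A\}$. $(X,\perp)$ is called linear if, for any two distinct elements $e,f\in X$, there is a third element $g\in X$ such that $\{e,f\}^{\perp}=\{e,g\}^{\perp}$ and exactly one of $f$ and $g$ is orthogonal to $e$. For disjoint sets $A,B$ and a bijection $\varphi\colon A\to B$, $\mathbf{2}(A,B,\varphi)$ denotes the orthogonality space with underlying set $A\cup B$ and orthogonality relation $\{(a,\varphi(a)): a\in A\}\cup\{(\varphi(a),a): a\in A\}$. *)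

(* Defs.v *)
From mathcomp Require Import all_boot.
From mathcomp Require Import boolp classical_sets functions cardinality.

Set Implicit Arguments.
Unset Strict Implicit.
Unset Printing Implicit Defensive.

Local Open Scope classical_set_scope.
Local Open Scope card_scope.

(* The underlying set is a subset [pts] of an ambient type [U], and [perp] is a
   relation on that subset: it holds only between elements of [pts]. Hence
   Leibniz equality of orthogonality spaces over [U] amounts to equality of the
   underlying sets and of the orthogonality relations. *)
Record orthoSpace (U : Type) := OrthoSpace {
  pts : set U;
  perp : U -> U -> Prop;
  pts_neq0 : pts !=set0;
  perp_pts : forall x y, perp x y -> pts x /\ pts y;
  perp_sym : forall x y, perp x y -> perp y x;
  perp_irr : forall x, ~ perp x x
}.

Section OrthoSpaceTheory.
Variables (U : Type) (X : orthoSpace U).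

Definition orthocompl (A : set U) : set U :=
  [set x | pts X x /\ forall a, A a -> perp X x a].

Definition mutually_orthogonal (D : set U) : Prop :=
  D `<=` pts X /\ forall x y, D x -> D y -> x <> y -> perp X x y.

(* The rank is a cardinal number, represented by any set [K] of that
   cardinality; it is the least upper bound for the order [#<=] of the
   cardinalities of the sets of mutually orthogonal elements. *)
Definition has_rank (V : Type) (K : set V) : Prop :=
  (forall D, mutually_orthogonal D -> D #<= K) /\
  (forall (W : Type) (L : set W),
      (forall D, mutually_orthogonal D -> D #<= L) -> K #<= L).

Definition linear_os : Prop :=
  forall e f, pts X e -> pts X f -> e <> f ->
  exists g, [/\ pts X g, g <> e, g <> f,
    orthocompl [set e; f] = orthocompl [set e; g] &
    (perp X f e /\ ~ perp X g e) \/ (~ perp X f e /\ perp X g e)].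

End OrthoSpaceTheory.

Section Two.
Variables (U : Type) (A B : set U) (phi : U -> U).

Definition two_perp (x y : U) : Prop :=
  (A x /\ y = phi x) \/ (A y /\ x = phi y).

Hypotheses (A0 : A !=set0) (dAB : A `&` B = set0) (bij : set_bij A B phi).

Let phiAB a : A a -> B (phi a).
Proof. by case: bij => fAB _ _ Aa; apply: fAB. Qed.

Lemma two_neq0 : (A `|` B) !=set0.
Proof. by case: A0 => a Aa; exists a; left. Qed.

Lemma two_perp_pts x y : two_perp x y -> (A `|` B) x /\ (A `|` B) y.
Proof.
by case=> -[Az ->]; split; [left | right; apply: phiAB
                            | right; apply: phiAB | left].
Qed.

Lemma two_perp_sym x y : two_perp x y -> two_perp y x.
Proof. by case=> h; [right | left]. Qed.

Lemma two_perp_irr x : ~ two_perp x x.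
Proof.
have no z : A z -> z = phi z -> False.
  move=> Az ez; suff: (A `&` B) z by rewrite dAB.
  by split=> //; rewrite ez; apply: phiAB.
by case=> -[Ax ex]; apply: (no x).
Qed.

(* The space 2(A, B, phi); an orthogonality space being non-empty, A has to be
   non-empty. The values of [phi] outside [A] are irrelevant. *)
Definition two : orthoSpace U :=
  OrthoSpace two_neq0 two_perp_pts two_perp_sym two_perp_irr.

End Two.

(* Main.v *)
(** In a rank-2 linear space every point [x] is orthogonal to exactly one point:
    linearity yields some orthogonal point, and two distinct points [f], [f']
    of [{x}^⊥] would yield, through the third point [g] of the line spanned by
    [f] and [f'], a triple of mutually orthogonal points. Orthogonality is thus
    a fixed-point free involution, and [A] is a set of representatives of its
    orbits. Conversely, in [2(A, B, phi)] any two distinct points have an empty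
    common orthocomplement, so that linearity only asks for a suitable [g]. *)
Require Import Defs.
From mathcomp Require Import all_boot.
From mathcomp Require Import boolp classical_sets functions cardinality.

Local Open Scope classical_set_scope.
Local Open Scope card_scope.

Lemma II_card_le (T : Type) (A : set T) n (f : nat -> T) :
  set_fun `I_n A f -> set_inj `I_n f -> `I_n #<= A.
Proof.
move=> fA finj; apply: (@card_le_trans _ _ _ (f @` `I_n)).
  by have := inj_card_eq finj; rewrite card_eq_sym card_eq_le => /andP[].
by apply: subset_card_le => _ [i ni <-]; apply: fA.
Qed.

Lemma II2_card_leP (T : Type) (A : set T) :
  `I_2 #<= A <-> exists a b, [/\ A a, A b & a <> b].
Proof.
split=> [A2|[a [b [Aa Ab ab]]]].
  apply: contrapT => no.
  (* Without two distinct points, [A] lies in the image of a one-point set. *)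
  suff A1 : A #<= `I_1 by have := card_le_trans A2 A1; rewrite card_le_II.
  have [->|/set0P[a Aa]] := eqVneq A set0; first exact: card_ge0.
  apply: card_le_trans (card_image_le (fun=> a) `I_1).
  apply: subset_card_le => b Ab; exists 0 => //.
  by apply: contrapT => ab; apply: no; exists a, b.
apply: (@II_card_le _ _ _ (fun i => if i is 0 then a else b)).
  by move=> [|i].
move=> [|[|i]] [|[|j]] /set_mem //= _ /set_mem //= _ e; case: ab; by rewrite e.
Qed.

Lemma set2_card_le (T : Type) (a b : T) : [set a; b] #<= `I_2.
Proof.
apply: card_le_trans (card_image_le (fun i => if i is 0 then a else b) `I_2).
by apply: subset_card_le => x [] ->; [exists 0 | exists 1].
Qed.

Section OrthoSpace.
Context {U : Type}.
Implicit Types X Y : orthoSpace U.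

Lemma orthoSpace_eq X Y : pts X = pts Y -> perp X = perp Y -> X = Y.
Proof.
case: X Y => [P p ? ? ? ?] [Q q ? ? ? ?] /= PQ pq; subst Q q.
by congr OrthoSpace; apply: Prop_irrelevance.
Qed.

Lemma perp_neq X x y : perp X x y -> x <> y.
Proof. by move=> + e; rewrite e; apply: perp_irr. Qed.

(** Such a triple would be a mutually orthogonal set of cardinality 3. *)
Lemma rank2_no_triangle X a b c :
  has_rank X `I_2 -> perp X a b -> perp X a c -> ~ perp X b c.
Proof.
move=> [rk _] ab ac bc.
have D3 : `I_3 #<= [set a; b; c].
  apply: (@II_card_le _ _ _ (nth a [:: a; b; c])).
    by move=> [|[|[|i]]] //= _; [left; left | left; right | right].
  move=> [|[|[|i]]] [|[|[|j]]] /set_mem //= _ /set_mem //= _ e.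
  - by case: (perp_neq _ _ _ ab).
  - by case: (perp_neq _ _ _ ac).
  - by case: (perp_neq _ _ _ ab).
  - by case: (perp_neq _ _ _ bc).
  - by case: (perp_neq _ _ _ ac).
  - by case: (perp_neq _ _ _ bc).
suff /rk D2 : mutually_orthogonal X [set a; b; c].
  by have := card_le_trans D3 D2; rewrite card_le_II.
split=> [x [[->|->]|->]|x y [[->|->]|->] [[->|->]|->] xy] //.
- by have [] := perp_pts ab.
- by have [] := perp_pts ab.
- by have [] := perp_pts bc.
- exact: perp_sym.
- exact: perp_sym.
- exact: perp_sym.
Qed.

Lemma linear_rank2_perp_uniq X : linear_os X -> has_rank X `I_2 ->
  forall x y z, perp X x y -> perp X x z -> y = z.
Proof.
move=> lin rk x f f' xf xf'; apply: contrapT => ff'.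
have [Xx Xf] := perp_pts xf; have [_ Xf'] := perp_pts xf'.
(* Either [f'] is orthogonal to [f], or [g] is; in the latter case [x] lies in
   [{f, f'}^⊥ = {f, g}^⊥]. Both cases give a triangle on [x] and [f]. *)
have [g [_ _ _ eqO [[f'f _]|[_ gf]]]] := lin f f' Xf Xf' ff'.
  exact: (rank2_no_triangle _ _ _ _ rk xf' xf f'f).
have [_ xfg] : orthocompl X [set f; g] x by rewrite -eqO; split=> // y [->|->].
by apply: (rank2_no_triangle _ _ _ _ rk _ xf gf); apply: xfg; right.
Qed.

(** The cardinality of the whole space bounds that of every mutually orthogonal set, hence also the
    least upper bound 2. *)
Lemma rank2_two_pts X : has_rank X `I_2 ->
  exists a b, [/\ pts X a, pts X b & a <> b].
Proof. by move=> [_ lub]; apply/II2_card_leP/lub => D [DX _]; apply: subset_card_le. Qed.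

Lemma linear_rank2_perp_ex X : linear_os X -> has_rank X `I_2 ->
  forall x, pts X x -> exists y, perp X x y.
Proof.
move=> lin /rank2_two_pts[a [b [Xa Xb ab]]] x Xx.
have [y [Xy xy]] : exists y, pts X y /\ x <> y.
  by have [xa|xa] := pselect (x = a); [exists b; rewrite xa | exists a].
have [g [_ _ _ _ [[p _]|[_ p]]]] := lin x y Xx Xy xy; first by exists y; apply: perp_sym.
by exists g; apply: perp_sym.
Qed.

(* [A] collects the points selected from their orbit [{x, x^⊥}]; as the choice
   depends only on the orbit as a set, exactly one point of each is selected. *)
Lemma perp_functional_two X :
  (forall x, pts X x -> exists y, perp X x y) ->
  (forall x y z, perp X x y -> perp X x z -> y = z) ->
  exists (A B : set U) (phi : U -> U)
    (A0 : A !=set0) (dAB : A `&` B = set0) (bij : set_bij A B phi),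
    X = two A0 dAB bij.
Proof.
move=> ex uniq; have [x0 Xx0] := pts_neq0 X.
have [phi phiP] : {phi & forall x, pts X x -> perp X x (phi x)}.
  (* The value [x0] is a mere default outside the space, and below for the empty set. *)
  apply: (choice (P := fun x y => pts X x -> perp X x y)) => x.
  have [/ex[y xy]|Xx] := pselect (pts X x); first by exists y.
  by exists x0.
have [sel selP] : {sel : set U -> U & forall S, S !=set0 -> S (sel S)}.
  apply: (choice (P := fun (S : set U) y => S !=set0 -> S y)) => S.
  have [[y Sy]|S0] := pselect (S !=set0); first by exists y.
  by exists x0.
pose orb x : set U := [set y | y = x \/ perp X x y].
have orbE x y : perp X x y -> orb x = orb y.
  move=> xy; apply/seteqP; split=> z [->|xz].
  - by right; apply: perp_sym.
  - by left; apply: (uniq x).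
  - by right.
  - by left; apply: (uniq y) => //; apply: perp_sym.
have selV x : sel (orb x) = x \/ perp X x (sel (orb x)).
  by apply: (selP (orb x)); exists x; left.
pose A := [set x | pts X x /\ sel (orb x) = x].
pose B := [set x | pts X x /\ sel (orb x) <> x].
(* Orthogonal points share their orbit and hence its selected point, so orthogonality exchanges [A]
   and [B]. *)
have AB x y : perp X x y -> A x -> B y.
  move=> xy [_ sx]; split; first by have [] := perp_pts xy.
  by rewrite -(orbE _ _ xy) sx; apply: perp_neq xy.
have BA x y : perp X x y -> B x -> A y.
  move=> xy [_ sx]; split; first by have [] := perp_pts xy.
  by rewrite -(orbE _ _ xy); case: (selV x) => // xs; apply: (uniq x).
have ptsAB : pts X = A `|` B.
  apply/seteqP; split=> [x Xx|x [[]|[]]] //.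
  by have [sx|sx] := pselect (sel (orb x) = x); [left | right].
have A0 : A !=set0.
  move: (Xx0); rewrite ptsAB => -[Ax|Bx]; first by exists x0.
  by exists (phi x0); apply: (BA x0) => //; apply: phiP.
have dAB : A `&` B = set0 by apply/seteqP; split=> // x [[_ e] [_]]; apply.
have bij : set_bij A B phi.
  split.
  - by move=> x Ax; apply: (AB x) => //; apply: phiP; case: Ax.
  - move=> x y /set_mem[Xx _] /set_mem[Xy _] e.
    (* Both [x] and [y] are orthogonal to the common value [phi x = phi y]. *)
    apply: (uniq (phi x)); first by apply: perp_sym; apply: phiP.
    by rewrite e; apply: perp_sym; apply: phiP.
  - move=> y By; have [Xy _] := By; have yp := phiP _ Xy.
    have Ap := BA _ _ yp By; exists (phi y) => //.
    apply: (uniq (phi y)); last exact: perp_sym.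
    by apply: phiP; case: Ap.
exists A, B, phi, A0, dAB, bij; apply: orthoSpace_eq => //=.
apply/funext => x; apply/funext => y; apply/propext; split.
  move=> xy; have [Xx Xy] := perp_pts xy; move: (Xx); rewrite ptsAB => -[Ax|Bx].
    by left; split=> //; apply: (uniq x) => //; apply: phiP.
  right; split; first exact: BA Bx.
  by apply: (uniq y); [apply: perp_sym | apply: phiP].
case=> -[[Xz _] ->]; first exact: phiP.
by apply: perp_sym; apply: phiP.
Qed.

(** The pair [{a, b}] shows that the rank is at least 2. In a mutually orthogonal set, all points
    other than a given [x] are orthogonal to [x], so there is at most one of them. *)
Lemma perp_functional_rank2 X a b : perp X a b ->
  (forall x y z, perp X x y -> perp X x z -> y = z) -> has_rank X `I_2.
Proof.
move=> ab uniq; split=> [D [DX Dp]|W L]; last first.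
  move=> ub; apply: (card_le_trans _ (ub [set a; b] _)).
    apply/II2_card_leP; exists a, b; split; [by left | by right |].
    exact: perp_neq ab.
  have [Xa Xb] := perp_pts ab.
  split=> [x [] ->|x y [->|->] [->|->]] // _.
  exact: perp_sym.
have [->|/set0P[x Dx]] := eqVneq D set0; first exact: card_ge0.
have [[y [Dy xy]]|no] := pselect (exists y, D y /\ x <> y).
  apply: card_le_trans (set2_card_le _ x y); apply: subset_card_le => z Dz.
  have [->|zx] := pselect (z = x); first by left.
  by right; apply: (uniq x); apply: Dp => //; apply: nesym.
apply: card_le_trans (set2_card_le _ x x); apply: subset_card_le => z Dz.
by left; apply: contrapT => zx; apply: no; exists z; split=> // /esym.
Qed.

Lemma perp_functional_orthocompl2 X e f :
  (forall x y z, perp X x y -> perp X x z -> y = z) -> e <> f ->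
  orthocompl X [set e; f] = set0.
Proof.
move=> uniq ef; apply/seteqP; split=> // x [_ h]; apply: ef.
by apply: (uniq x); apply: h; [left | right].
Qed.

(** Both orthocomplements are empty. If [f] is orthogonal to [e], any third point serves as [g], by
    uniqueness; otherwise the point orthogonal to [e] does. *)
Lemma perp_functional_linear X :
  (forall x, pts X x -> exists y, perp X x y) ->
  (forall x y z, perp X x y -> perp X x z -> y = z) ->
  (forall e f, perp X e f -> exists g, [/\ pts X g, g <> e & g <> f]) ->
  linear_os X.
Proof.
move=> ex uniq third e f Xe Xf ef.
suff [g [Xg ge gf h]] : exists g, [/\ pts X g, g <> e, g <> f &
    (perp X f e /\ ~ perp X g e) \/ (~ perp X f e /\ perp X g e)].
  exists g; split=> //; rewrite !perp_functional_orthocompl2 //.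
  exact: nesym.
have [fe|nfe] := pselect (perp X f e).
  have [g [Xg ge gf]] := third _ _ (perp_sym fe).
  exists g; split=> //; left; split=> // g_e; apply: gf.
  by apply: (uniq e); apply: perp_sym.
have [g eg] := ex _ Xe; have [_ Xg] := perp_pts eg.
exists g; split=> //.
- exact/nesym/(perp_neq _ _ _ eg).
- by move=> gf; apply: nfe; rewrite -gf; apply: perp_sym.
- by right; split=> //; apply: perp_sym.
Qed.

Section Two.
Variables (A B : set U) (phi : U -> U).
Hypotheses (A0 : A !=set0) (dAB : A `&` B = set0) (bij : set_bij A B phi).

Let disj x : A x -> ~ B x.
Proof. by move=> Ax Bx; have : (A `&` B) x by []; rewrite dAB. Qed.

Let phiB x : A x -> B (phi x).
Proof. by case: bij => + _ _; apply. Qed.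

Let phiI x y : A x -> A y -> phi x = phi y -> x = y.
Proof. by case: bij => _ + _ Ax Ay; apply; apply/mem_set. Qed.

Lemma two_perp_ex x : pts (two A0 dAB bij) x -> exists y, perp (two A0 dAB bij) x y.
Proof.
case=> [Ax|]; first by exists (phi x); left.
by have [_ _ surj] := bij; move=> /surj[a Aa <-]; exists a; right.
Qed.

(** Disjointness excludes the mixed cases; on [B], injectivity of [phi] gives uniqueness. *)
Lemma two_perp_uniq x y z :
  perp (two A0 dAB bij) x y -> perp (two A0 dAB bij) x z -> y = z.
Proof.
case=> [[Ax ->]|[Ay ->]] [[Ap e]|[Az e]] //=.
- by case: (disj _ Ax); rewrite e; apply: phiB.
- by case: (disj _ Ap); apply: phiB.
- exact: phiI e.
Qed.

Lemma two_perp_third (A2 : `I_2 #<= A) e f : perp (two A0 dAB bij) e f ->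
  exists g, [/\ pts (two A0 dAB bij) g, g <> e & g <> f].
Proof.
(* A second element of [A] works: it cannot equal [phi a], which lies in [B]. *)
have third a : A a -> exists g, [/\ A g, g <> a & g <> phi a].
  move=> Aa; have [b [c [Ab Ac bc]]] := (II2_card_leP _ _).1 A2.
  have [g [Ag ga]] : exists g, A g /\ g <> a.
    by have [ba|] := pselect (b = a); [exists c; rewrite -ba; split=> // /esym | exists b].
  by exists g; split=> // gpa; apply: (disj _ Ag); rewrite gpa; apply: phiB.
by case=> -[Aa ->]; have [g [Ag g1 g2]] := third _ Aa; exists g; split=> //; left.
Qed.

(** Linearity applied to [a] and [phi a] yields a third point; this point, or its preimage under
    [phi] if it lies in [B], is a second element of [A]. *)
Lemma two_linear_card : linear_os (two A0 dAB bij) -> `I_2 #<= A.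
Proof.
move=> lin; have [a Aa] := A0.
have ap : a <> phi a by move=> e; apply: (disj _ Aa); rewrite e; apply: phiB.
have [g [[Ag|Bg] ga gp _ _]] :=
  lin a (phi a) (or_introl Aa) (or_intror (phiB _ Aa)) ap.
  by apply/II2_card_leP; exists g, a.
have [_ _ /(_ g Bg)[b Ab bg]] := bij.
by apply/II2_card_leP; exists b, a; split=> // ba; apply: gp; rewrite -bg ba.
Qed.

End Two.

End OrthoSpace.

Theorem proposition29 (U : Type) :
  (forall X : orthoSpace U,
     linear_os X -> has_rank X `I_2 ->
     exists (A B : set U) (phi : U -> U)
            (A0 : A !=set0) (dAB : A `&` B = set0) (bij : set_bij A B phi),
       `I_2 #<= A /\ X = two A0 dAB bij) /\
  (forall (X : orthoSpace U) (A B : set U) (phi : U -> U)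
          (A0 : A !=set0) (dAB : A `&` B = set0) (bij : set_bij A B phi),
     `I_2 #<= A -> X = two A0 dAB bij ->
     has_rank X `I_2 /\ linear_os X).
Proof.
split=> [X lin rk|X A B phi A0 dAB bij A2 ->].
  have [A [B [phi [A0 [dAB [bij XE]]]]]] := perp_functional_two X
    (linear_rank2_perp_ex X lin rk) (linear_rank2_perp_uniq X lin rk).
  exists A, B, phi, A0, dAB, bij; split=> //.
  by apply: (two_linear_card A B phi A0 dAB bij); rewrite -XE.
have uniq := two_perp_uniq A B phi A0 dAB bij.
split; last first.
  apply: perp_functional_linear => //; first exact: two_perp_ex.
  exact: two_perp_third.
have [a Aa] := A0.
by apply: (perp_functional_rank2 _ a (phi a)) => //; left.
Qed.
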